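(* Let $A\subset[0,1]$ be a perfect set with $0\in A$. Then there exists a set $E\subset\mathbb{R}^2$ of two-dimensional Lebesgue measure zero such that: (i) $E$ contains, in every direction in $S^1\setminus\{(\pm1,0)\}$, a unit line segment centered in $A\times\{0\}$; that is, for every $e\in S^1\setminus\{(1,0),(-1,0)\}$ there exists $a\in A$ such that $\{(a,0)+te : t\in[-\tfrac12,\tfrac12]\}\subset E$; (ii) $E\cap(\mathbb{R}\times\{0\})=A\times\{0\}$; and (iii) $E\cup([-1,2]\times\{0\})$ is compact.
   Context: A subset of $\mathbb{R}^d$ is called perfect if it is closed and has no isolated points. A unit line segment in direction $e\in S^1$ (the unit circle in $\mathbb{R}^2$) with center $p\in\mathbb{R}^2$ is the closed segment $\{p+te : t\in[-\tfrac12,\tfrac12]\}$ of length $1$. *)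

(* Defs.v *)
From HB Require Import structures.
From mathcomp Require Import all_boot all_order all_algebra.
From mathcomp Require Import all_classical all_reals all_analysis.

Set Implicit Arguments.
Unset Strict Implicit.
Unset Printing Implicit Defensive.

Import Order.TTheory GRing.Theory Num.Theory.
Import numFieldNormedType.Exports.

Local Open Scope classical_set_scope.
Local Open Scope ring_scope.

(* The norm of the normed module R * R is the sup norm, so the Euclidean unit
   circle is written with coordinates. *)
Definition unit_circle (R : realType) : set (R * R) :=
  [set e | e.1 ^+ 2 + e.2 ^+ 2 = 1].

Definition unit_segment (R : realType) (p e : R * R) : set (R * R) :=
  [set p + t *: e | t in `[- 2^-1, 2^-1]].

Definition lebesgue_measure2 (R : realType) :
    set (measurableTypeR R * measurableTypeR R) -> \bar R :=
  (lebesgue_measure \x lebesgue_measure)%E.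

(* Main.v *)
(* Write a non-horizontal line as x = a + s y, with label a in A and slope s.  The
   labels a(s) are found as a limit of piecewise constant functions of s, so that
   at every height y <> 0 the set of all a(s) + s y is null.

   One refinement step: given a label a, pick alpha, beta in A near a, which is
   possible since A has no isolated point, cut the interval of slopes into pieces
   and give the label alpha to the left half and beta to the right half of each.
   If the pieces have length 2h with alpha - beta close to y h, then at height y the
   two halves have nearly the same trace.  Since the labels cannot be prescribed,
   the gain comes from iterating at widely separated scales: if the traces can be
   thinned to density c in every interval, thin first the left halves and then, at
   a much finer scale, the right halves.  The traces then overlap as if they were
   independent, and the density becomes about (2 c - c^2) / 2 = c - c^2 / 2.
   Iterating, the density falls below any eps, for all y in a range
   |y - y0| <= delta |y0| where delta depends on eps only; hence countably many
   values of y0 suffice to treat all y <> 0. *)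

Require Import Defs.
From HB Require Import structures.
From mathcomp Require Import all_boot all_order all_algebra.
From mathcomp Require Import all_classical all_reals all_analysis.
From mathcomp Require Import ring lra measurable_realfun.

Import Order.TTheory GRing.Theory Num.Theory.
Import numFieldNormedType.Exports.

Local Open Scope classical_set_scope.
Local Open Scope ring_scope.

(** * Length of sets of reals inside a bounded window *)

Section Length.
Context {R : realType}.
Implicit Types (X Y L : set R) (B x y z p q r : R).

(** Cutting down to a window keeps lengths finite, so that they are real numbers open to linear
    arithmetic. *)
Definition len B X : R := fine (lebesgue_measure (X `&` `[- B, B])).

Definition cball z r : set R := [set x | `|x - z| <= r].

Lemma cball_itv z r : cball z r = `[z - r, z + r]%classic.
Proof.
by apply/seteqP; split=> x; rewrite /cball /= in_itv /= ler_distl.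
Qed.

Lemma measurable_cball z r : measurable (cball z r).
Proof. by rewrite cball_itv; exact: measurable_itv. Qed.

Lemma lebesgue_measure_itvcc p q : p <= q ->
  lebesgue_measure (`[p, q]%classic : set R) = (q - p)%:E.
Proof.
move=> pq; rewrite lebesgue_measure_itv /= lte_fin.
case: ltP => // qp; have -> : p = q by apply/le_anti; rewrite pq qp.
by rewrite subrr.
Qed.

Lemma lenE B X : measurable X ->
  lebesgue_measure (X `&` `[- B, B]) = (len B X)%:E.
Proof.
move=> mX; rewrite /len fineK// ge0_fin_numE//.
apply: (@le_lt_trans _ _ (lebesgue_measure (`[- B, B]%classic : set R))).
  by apply: le_measure; rewrite ?inE //=; apply: measurableI => //.
by rewrite lebesgue_measure_itv /=; case: ifP => _; rewrite ltry.
Qed.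

Lemma len_ge0 B X : 0 <= len B X.
Proof. by rewrite /len fine_ge0. Qed.

Lemma le_len B X Y : measurable X -> measurable Y -> X `<=` Y ->
  len B X <= len B Y.
Proof.
move=> mX mY XY; rewrite -lee_fin -!lenE//.
apply: le_measure; rewrite ?inE; [exact: measurableI|exact: measurableI|].
exact: setSI.
Qed.

Lemma lenU B X Y : measurable X -> measurable Y ->
  len B (X `|` Y) <= len B X + len B Y.
Proof.
move=> mX mY; rewrite -lee_fin EFinD -!lenE//; last exact: measurableU.
by rewrite setIUl; apply: measureU2; exact: measurableI.
Qed.

Lemma lenID B X Y : measurable X -> measurable Y ->
  len B X = len B (X `&` Y) + len B (X `\` Y).
Proof.
move=> mX mY; apply: EFin_inj; rewrite EFinD -!lenE//;
  [|exact: measurableD|exact: measurableI].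
have mXY : measurable (X `&` Y `&` `[- B, B]).
  by apply: measurableI => //; exact: measurableI.
have mXD : measurable ((X `\` Y) `&` `[- B, B]).
  by apply: measurableI => //; exact: measurableD.
rewrite -measureU//; last first.
  by rewrite -subset0 => x [[[_ Yx] _] [[_ nYx] _]].
by rewrite -setIUl setUIDK.
Qed.

Lemma len_le_measure B X r : measurable X ->
  (lebesgue_measure X <= r%:E)%E -> len B X <= r.
Proof.
move=> mX /(le_trans _) Xr; rewrite -lee_fin -lenE//; apply: Xr.
by apply: le_measure; rewrite ?inE//; exact: measurableI.
Qed.

Lemma len_cball_le B z r : 0 <= r -> len B (cball z r) <= 2 * r.
Proof.
move=> r0; apply: len_le_measure; first exact: measurable_cball.
by rewrite cball_itv lebesgue_measure_itvcc ?lee_fin; lra.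
Qed.

Lemma len_set0 B : len B set0 = 0.
Proof. by rewrite /len set0I measure0. Qed.

Lemma is_intervalI X Y : is_interval X -> is_interval Y -> is_interval (X `&` Y).
Proof.
move=> iX iY x y [Xx Yx] [Xy Yy] z xzy; split.
- exact: iX Xx Xy _ xzy.
- exact: iY Yx Yy _ xzy.
Qed.

Lemma is_interval_itv (i : interval R) : is_interval [set` i].
Proof. exact: interval_is_interval. Qed.

Lemma is_interval_cball z r : is_interval (cball z r).
Proof. by rewrite cball_itv; exact: is_interval_itv. Qed.

(** The endpoints are the infimum and supremum of the truncated interval, which lies between the
    open and the closed interval they span. *)
Lemma len_interval B L : is_interval L -> L `&` `[- B, B] !=set0 ->
  exists p q, [/\ p <= q, len B L = q - p & L `&` `[- B, B] `<=` `[p, q]].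
Proof.
set X := L `&` _ => iL [x0 Xx0].
have iX : is_interval X by apply: is_intervalI => //; exact: is_interval_itv.
have hs : has_sup X.
  split; first by exists x0.
  by exists B => x [_ /=]; rewrite in_itv/= => /andP[].
have hi : has_inf X.
  split; first by exists x0.
  by exists (- B) => x [_ /=]; rewrite in_itv/= => /andP[].
have sub : X `<=` `[inf X, sup X].
  move=> x Xx /=; rewrite in_itv /=; apply/andP; split.
  - by apply: ge_inf => //; case: hi.
  - by apply: ub_le_sup => //; case: hs.
have mX : measurable X by exact: is_interval_measurable.
have pq : inf X <= sup X.
  by have := sub _ Xx0; rewrite /= in_itv/= => /andP[]; exact: le_trans.
exists (inf X), (sup X); split => //.
have sub2 : `]inf X, sup X[ `<=` X.
  move=> x /=; rewrite in_itv /= => /andP[ix xs].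
  have [u Xu ux] := inf_lt hi.1 ix.
  have [v Xv xv] := sup_gt hs.1 xs.
  by apply: (iX _ _ Xu Xv); rewrite !ltW.
apply/EFin_inj; rewrite -lenE; last exact: is_interval_measurable.
apply/eqP; rewrite eq_le; apply/andP; split.
  rewrite -lebesgue_measure_itvcc//; apply: le_measure; rewrite ?inE//.
apply: (@le_trans _ _ (lebesgue_measure `]inf X, sup X[%classic)).
  rewrite lebesgue_measure_itv /= lte_fin; case: ltP => // h.
  by rewrite lee_fin subr_le0.
by apply: le_measure; rewrite ?inE//.
Qed.

End Length.

(** * Removing balls from an interval, and balls in arithmetic progression *)

Section Balls.
Context {R : realType}.
Implicit Types (X Y L S J : set R) (B x y z p q r c tau : R) (G : seq (R * R)).

Definition balls G : set R := [set x | exists2 g, g \in G & cball g.1 g.2 x].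

Lemma balls_nil : balls [::] = set0.
Proof. by apply/seteqP; split=> // x []. Qed.

Lemma balls_cons g G : balls (g :: G) = cball g.1 g.2 `|` balls G.
Proof.
apply/seteqP; split=> x.
  by case=> h; rewrite inE => /predU1P[->|hG] xh; [left|right; exists h].
by case=> [xg|[h hG xh]]; [exists g|exists h] => //; rewrite inE ?eqxx ?hG ?orbT.
Qed.

Lemma balls_cat G1 G2 : balls (G1 ++ G2) = balls G1 `|` balls G2.
Proof.
elim: G1 => [|g G1 IH]; first by rewrite balls_nil set0U.
by rewrite cat_cons !balls_cons IH setUA.
Qed.

Lemma measurable_balls G : measurable (balls G).
Proof.
elim: G => [|g G IH]; first by rewrite balls_nil; exact: measurable0.
by rewrite balls_cons; apply: measurableU => //; exact: measurable_cball.
Qed.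

(** Removing a ball splits an interval into two, so removing all of [G] leaves at most [2 ^+ size G]
    intervals, and the hypothesis costs [tau] on each. *)
Lemma len_setD_balls B S J c tau G L : measurable S -> measurable J ->
  (forall I, is_interval I -> len B (I `&` S) <= c * len B (I `&` J) + tau) ->
  is_interval L ->
  len B (L `&` S `\` balls G) <= c * len B (L `&` J `\` balls G) + 2 ^+ size G * tau.
Proof.
move=> mS mJ SJ; elim: G L => [|[z r] G IH] L iL.
  by rewrite balls_nil !setD0 expr0 mul1r; exact: SJ.
pose L1 := L `&` `]-oo, z - r[.
(* A negative radius is allowed: the ball is then empty, and the first ray keeps [L2] disjoint from
   [L1]. *)
pose L2 := L `&` (`[z - r, +oo[ `&` `]z + r, +oo[).
have iL1 : is_interval L1 by apply: is_intervalI => //; exact: is_interval_itv.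
have iL2 : is_interval L2.
  by do 2! (apply: is_intervalI => //); exact: is_interval_itv.
have mL : measurable L by exact: is_interval_measurable.
have mlo : measurable (`]-oo, z - r[%classic : set R) by exact: measurable_itv.
have E T : measurable T -> len B (L `&` T `\` balls ((z, r) :: G)) =
    len B (L1 `&` T `\` balls G) + len B (L2 `&` T `\` balls G).
  move=> mT; rewrite (@lenID _ _ _ `]-oo, z - r[%classic)//; last first.
    apply: measurableD; last exact: measurable_balls.
    exact: measurableI.
  rewrite balls_cons; congr (len _ _ + len _ _).
  - apply/seteqP; split=> x.
      move=> [[[Lx Tx] nx] xlo]; split; last by move=> /(@or_intror _ _)/nx.
      by split.
    move=> [[[Lx xlo] Tx] nx]; split => //; split => //.
    move=> [|//]; rewrite cball_itv /= in_itv /= => /andP[xge _].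
    by move: xlo; rewrite /= in_itv /= ltNge xge.
  - apply/seteqP; split=> x.
      move=> [[[Lx Tx] nx] /= /negP]; rewrite /= ?in_itv /= -leNgt => xge.
      split; last by move=> /(@or_intror _ _)/nx.
      split => //; split => //; split; rewrite /= !in_itv /= ?andbT//.
      rewrite ltNge; apply/negP => xle; apply: nx; left.
      by rewrite cball_itv /= in_itv /= xge.
    move=> [[[Lx [x1 x2]] Tx] nx].
    move: x1 x2; rewrite /= !in_itv /= !andbT => x1 x2.
    split; last by move=> /=; rewrite ltNge x1.
    split => //; move=> [|//]; rewrite cball_itv /= in_itv /= => /andP[_ xle].
    by move: x2; rewrite ltNge xle.
rewrite !E//= exprS.
have := IH _ iL1; have := IH _ iL2.
lra.
Qed.

(** For [0 <= r], [clamp r (x - z) + r] is the length of the part of [cball z r] to the left of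
    [x]. *)
Definition clamp r x : R := Num.max (- r) (Num.min x r).

Lemma clampP r x : 0 <= r ->
  [\/ x <= - r /\ clamp r x = - r, - r <= x <= r /\ clamp r x = x | r <= x /\ clamp r x = r].
Proof.
move=> r0; rewrite /clamp.
have [xr|/ltW rx] := leP x r; last by apply: Or33; split=> //; apply: max_r; lra.
have [?|/ltW ?] := leP (- r) x; first by apply: Or32; split => //; apply/andP.
by apply: Or31; split.
Qed.

(** The endpoints are fixed before the ball, so that the bound can be summed over a family of
    balls. *)
Lemma len_interval_cball B L : is_interval L ->
  exists p q, [/\ p <= q, len B L = q - p &
    forall z r, 0 <= r -> len B (L `&` cball z r) <= clamp r (q - z) - clamp r (p - z)].
Proof.
move=> iL; have mL := is_interval_measurable iL.
have [Lne|Le] := pselect (L `&` `[- B, B] !=set0); last first.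
  exists 0, 0; have L0 : L `&` `[- B, B] = set0.
    by apply/eqP/negP => /negP/set0P.
  split => //; first by rewrite /len L0 measure0 subrr.
  move=> z r r0; rewrite subrr (_ : len _ _ = 0)// /len setIAC L0.
  by rewrite set0I measure0.
have [p [q [pq Lpq Lsub]]] := len_interval _ _ iL Lne.
exists p, q; split => // z r r0; rewrite -lee_fin -lenE; last first.
  by apply: measurableI => //; exact: measurable_cball.
have sub : L `&` cball z r `&` `[- B, B] `<=` `[z + clamp r (p - z), z + clamp r (q - z)].
  move=> x [[Lx]]; rewrite cball_itv /= !in_itv /= => /andP[x1 x2] xB.
  have := Lsub x (conj Lx xB); rewrite /= in_itv /= => /andP[px xq].
  rewrite /clamp; apply/andP; split.
  - by rewrite addrC -lerBrDr ge_max ge_min; apply/andP; split; [lra|apply/orP; left; lra].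
  - by rewrite addrC -lerBlDr le_max le_min; apply/orP; right; apply/andP; split; lra.
apply: (@le_trans _ _ (lebesgue_measure
  (`[z + clamp r (p - z), z + clamp r (q - z)]%classic : set R))).
  apply: le_measure => //; rewrite inE; last exact: measurable_itv.
  by apply: measurableI => //; apply: measurableI => //; exact: measurable_cball.
rewrite lebesgue_measure_itvcc ?lee_fin; first lra.
rewrite lerD2l; set u := p - z; set v := q - z.
have uv : u <= v by rewrite /u /v; lra.
by case: (clampP _ u r0) => -[? ->]; case: (clampP _ v r0) => -[? ->]; lra.
Qed.

Lemma clampN r x : 0 <= r -> clamp r (- x) = - clamp r x.
Proof.
by move=> r0; case: (clampP _ x r0) => -[? ->]; case: (clampP _ (- x) r0) => -[? ->]; lra.
Qed.

Lemma sum_clamp_gt n r v x : 0 <= r -> r <= v -> (2 * n%:R - 1) * v <= x ->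
  \sum_(j < n) (clamp r (x - 2 * j%:R * v) + r) = 2 * n%:R * r.
Proof.
move=> r0 rv xv; rewrite (eq_bigr (fun=> 2 * r)).
  by rewrite sumr_const card_ord -mulr_natr; ring.
move=> j _; have jn : (j%:R + 1 : R) <= n%:R by rewrite natr1 ler_nat.
have jv : (j%:R + 1) * v <= n%:R * v by rewrite ler_wpM2r//; lra.
by case: (clampP _ (x - 2 * j%:R * v) r0) => -[? ->]; lra.
Qed.

(* Up to an error r, the counting function of the balls of radius r centred at
   0, 2v, 4v, ... is linear with slope r/v, truncated at both ends. *)
Lemma sum_clamp n r v x : 0 <= r -> r <= v -> 0 < v ->
  let f := Num.max 0 (Num.min (x + v) (2 * n%:R * v)) in
  `|\sum_(j < n) (clamp r (x - 2 * j%:R * v) + r) - r / v * f| <= r.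
Proof.
move=> r0 rv v0 /=; elim: n => [|n IH].
  rewrite big_ord0 mulr0 mul0r sub0r.
  have -> : Num.max 0 (Num.min (x + v) 0) = 0.
    by apply/max_idPl; rewrite ge_min lexx orbT.
  by rewrite mulr0 oppr0 normr0.
rewrite big_ord_recr /=.
have n0 : (0 : R) <= n%:R by [].
have nv : 0 <= n%:R * v by rewrite mulr_ge0// ltW.
have -> : n.+1%:R = n%:R + 1 :> R by rewrite natr1.
(* Either [x] has not reached the cell of the new ball, which then contributes nothing, or all
   earlier balls count in full and only one cell remains to be compared. *)
have [xn|xn] := leP (x + v) (2 * n%:R * v).
  move: IH; rewrite (min_idPl xn).
  rewrite (@min_l _ _ (x + v)); last by lra.
  suff -> : clamp r (x - 2 * n%:R * v) + r = 0 by rewrite addr0.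
  by case: (clampP _ (x - 2 * n%:R * v) r0) => -[? ->]; lra.
rewrite sum_clamp_gt//; last by lra.
rewrite max_r; last by rewrite le_min; apply/andP; split; lra.
set t := x - 2 * n%:R * v.
have tv : - v < t by rewrite /t; lra.
have k0 : 0 <= r / v by rewrite divr_ge0// ltW.
have k1 : r / v <= 1 by rewrite ler_pdivrMr// mul1r.
have kv : r / v * v = r by rewrite mulfVK// gt_eqF.
move: (r / v) k0 k1 kv => k k0 k1 kv.
have -> : x = t + 2 * n%:R * v by rewrite /t; ring.
rewrite ler_norml; case: (leP (t + 2 * n%:R * v + v) (2 * (n%:R + 1) * v)) => tn.
  have tle : t <= v by lra.
  have kt : k * t <= r by rewrite -kv ler_wpM2l.
  have kt' : - r <= k * t by rewrite -kv -mulrN ler_wpM2l// ltW.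
  have e1 : k * (t + 2 * n%:R * v + v) = k * t + 2 * n%:R * r + r by rewrite -kv; ring.
  rewrite e1; have [t0|t0] := leP 0 t.
    have ktp : 0 <= k * t by rewrite mulr_ge0.
    have ktt : k * t <= t by rewrite ler_piMl.
    by case: (clampP _ t r0) => -[? ->]; lra.
  have ktp : k * t <= 0 by rewrite mulr_ge0_le0// ltW.
  have ktt : t <= k * t by rewrite ler_niMl// ltW.
  by case: (clampP _ t r0) => -[? ->]; lra.
have e1 : k * (2 * (n%:R + 1) * v) = 2 * n%:R * r + 2 * r by rewrite -kv; ring.
rewrite e1.
by case: (clampP _ t r0) => -[? ->]; lra.
Qed.

(** The truncated linear function approximating the count increases by at most [q - p] before
    scaling, and each endpoint costs an error [r]. *)
Lemma sum_clampB n r v p q : 0 <= r -> r <= v -> 0 < v -> p <= q ->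
  \sum_(j < n) (clamp r (q - 2 * j%:R * v) - clamp r (p - 2 * j%:R * v))
    <= r / v * (q - p) + 2 * r.
Proof.
move=> r0 rv v0 pq.
rewrite (eq_bigr (fun j : 'I_n => (clamp r (q - 2 * j%:R * v) + r)
  - (clamp r (p - 2 * j%:R * v) + r))); last by move=> j _; ring.
rewrite sumrB.
have := sum_clamp n _ _ p r0 rv v0; have := sum_clamp n _ _ q r0 rv v0.
rewrite /= !ler_norml; set fq := Num.max 0 _; set fp := Num.max 0 _.
have fpq : fq - fp <= q - p.
  rewrite /fq /fp.
  by case: (leP (q + v)) => ?; case: (leP (p + v)) => ?; do ! case: (leP 0) => ?; lra.
have : r / v * (fq - fp) <= r / v * (q - p).
  by rewrite ler_wpM2l// divr_ge0// ltW.
move: (r / v) => k; lra.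
Qed.

(** Balls of radius [r] with centres [2 * w] apart occupy the fraction [r / |w|] of the line; the
    two ends cost [2 * r], whatever [n] is. A negative [w] is treated by reflection. *)
Lemma sum_len_cball B L n z w r : is_interval L -> 0 <= r -> r <= `|w| -> w != 0 ->
  \sum_(j < n) len B (L `&` cball (z + 2 * j%:R * w) r)
    <= r / `|w| * len B L + 2 * r.
Proof.
move=> iL r0 rw w0; have [p [q [pq Lpq Lsub]]] := len_interval_cball B _ iL.
apply: (@le_trans _ _ (\sum_(j < n) (clamp r (q - (z + 2 * j%:R * w))
    - clamp r (p - (z + 2 * j%:R * w))))).
  by apply: ler_sum => j _; exact: Lsub.
have [wp|wn|/eqP] := ltgtP 0 w; last by rewrite eq_sym (negbTE w0).
  have := @sum_clampB n r w (p - z) (q - z) r0.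
  rewrite gtr0_norm// in rw *; move=> /(_ rw wp).
  have -> : q - z - (p - z) = q - p by ring.
  rewrite Lpq lerD2r => /(_ pq); apply: le_trans.
  by apply: ler_sum => j _; rewrite !opprD !addrA.
have := @sum_clampB n r (- w) (z - q) (z - p) r0.
rewrite ltr0_norm// in rw *; rewrite oppr_gt0 => /(_ rw wn).
have -> : z - p - (z - q) = q - p by ring.
rewrite Lpq => h; apply: le_trans (h _); last by lra.
apply: ler_sum => j _.
have -> : z - p - 2 * j%:R * - w = - (p - (z + 2 * j%:R * w)) by ring.
have -> : z - q - 2 * j%:R * - w = - (q - (z + 2 * j%:R * w)) by ring.
by rewrite !clampN// opprK addrC.
Qed.

End Balls.

(* A brick (a, m, w) stands for the lines x = a + s y with |s - m| <= w; its
   trace at height y is a ball of radius |y| w. *)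
Local Notation brick R := (R * R * R)%type.
Local Notation lab b := (b.1.1).
Local Notation mid b := (b.1.2).
Local Notation hwid b := (b.2).

(** * Bricks, their shadows and their refinements *)

Section Bricks.
Context {R : realType} (A : set R).
Implicit Types (L : set R) (B y s c tau : R) (b : brick R) (K : seq (brick R)).

Definition trace y b : set R := cball (lab b + y * mid b) (`|y| * hwid b).

Definition shadow y K : set R :=
  balls [seq (lab b + y * mid b, `|y| * hwid b) | b <- K].

Definition covers K s := exists2 b, b \in K & `|s - mid b| <= hwid b.

Definition width K := \sum_(b <- K) hwid b.

(** Nested slopes and bounded label shifts let refinements be composed; the bound on [width] keeps
    the total length of traces from growing along a sequence of refinements. *)
Definition refines tau K K' :=
  [/\ forall b', b' \in K' -> [/\ A (lab b'), 0 < hwid b' & exists2 b, b \in K &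
        `|lab b' - lab b| <= tau /\ `|mid b' - mid b| + hwid b' <= hwid b],
      forall s, covers K s -> covers K' s
    & width K' <= width K].

Lemma shadow1 y b : shadow y [:: b] = trace y b.
Proof. by rewrite /shadow /= balls_cons balls_nil setU0. Qed.

Lemma shadow_cat y K1 K2 : shadow y (K1 ++ K2) = shadow y K1 `|` shadow y K2.
Proof. by rewrite /shadow map_cat balls_cat. Qed.

Lemma shadowP y K x : shadow y K x <-> exists2 b, b \in K & trace y b x.
Proof.
split=> [[g /mapP[b bK ->] xg]|[b bK xb]]; first by exists b.
by exists (lab b + y * mid b, `|y| * hwid b) => //; exact: map_f.
Qed.

Lemma measurable_shadow y K : measurable (shadow y K).
Proof. exact: measurable_balls. Qed.

Lemma measurable_trace y b : measurable (trace y b).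
Proof. exact: measurable_cball. Qed.

Lemma width_cat K1 K2 : width (K1 ++ K2) = width K1 + width K2.
Proof. by rewrite /width big_cat. Qed.

Lemma covers_cat K1 K2 s : covers (K1 ++ K2) s <-> covers K1 s \/ covers K2 s.
Proof.
split=> [[b]|[[b bK bs]|[b bK bs]]].
- by rewrite mem_cat => /orP[bK|bK] bs; [left|right]; exists b.
- by exists b; rewrite // mem_cat bK.
- by exists b; rewrite // mem_cat bK orbT.
Qed.

Lemma refines_refl tau K : 0 <= tau ->
  (forall b, b \in K -> A (lab b) /\ 0 < hwid b) -> refines tau K K.
Proof.
move=> tau0 wfK; split=> // b bK; have [Ab b0] := wfK _ bK; split=> //.
by exists b => //; rewrite !subrr normr0 add0r.
Qed.

Lemma refines_nil tau : refines tau [::] [::].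
Proof. by split. Qed.

Lemma refines_cat tau K1 K2 K1' K2' : refines tau K1 K1' -> refines tau K2 K2' ->
  refines tau (K1 ++ K2) (K1' ++ K2').
Proof.
move=> [e1 c1 w1] [e2 c2 w2]; split.
- move=> b'; rewrite mem_cat => /orP[/e1|/e2] [Ab b0 [b bK bb]]; split => //;
  by exists b => //; rewrite mem_cat bK ?orbT.
- by move=> s /covers_cat[/c1|/c2] h; apply/covers_cat; [left|right].
- by rewrite !width_cat lerD.
Qed.

Lemma refines_flatten (I : eqType) tau (F F' : I -> seq (brick R)) (s : seq I) :
  (forall j, j \in s -> refines tau (F j) (F' j)) ->
  refines tau (flatten [seq F j | j <- s]) (flatten [seq F' j | j <- s]).
Proof.
elim: s => [_|j s IH FF']; first exact: refines_nil.
apply: refines_cat; first by apply: FF'; rewrite inE eqxx.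
by apply: IH => i si; apply: FF'; rewrite inE si orbT.
Qed.

Lemma refines_trans sigma tau K1 K2 K3 :
  refines sigma K1 K2 -> refines tau K2 K3 -> refines (sigma + tau) K1 K3.
Proof.
move=> [e1 c1 w1] [e2 c2 w2]; split.
- move=> b3 /e2[A3 w3 [b2 /e1[A2 _ [b1 b1K [l12 m12]]] [l23 m23]]].
  split=> //; exists b1 => //; split.
    have := ler_distD (lab b2) (lab b3) (lab b1); lra.
  have := ler_distD (mid b2) (mid b3) (mid b1); lra.
- by move=> s /c1/c2.
- exact: le_trans w1.
Qed.

Lemma refines_le sigma tau K K' : sigma <= tau -> refines sigma K K' -> refines tau K K'.
Proof.
move=> st [e c w]; split=> // b' /e[? ? [b bK [? ?]]]; split=> //; exists b => //.
by split=> //; lra.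
Qed.

Lemma len_shadow_flatten (I : eqType) B y L (F : I -> seq (brick R)) (s : seq I) :
  measurable L ->
  len B (L `&` shadow y (flatten [seq F j | j <- s]))
    <= \sum_(j <- s) len B (L `&` shadow y (F j)).
Proof.
move=> mL; elim: s => [|j s IH].
  by rewrite big_nil /shadow /= balls_nil setI0 len_set0.
rewrite big_cons /= shadow_cat setIUr; apply: le_trans (lenU _ _ _ _ _) _.
- by apply: measurableI => //; exact: measurable_shadow.
- by apply: measurableI => //; exact: measurable_shadow.
- by rewrite lerD2l.
Qed.

Lemma grid_cover n (h u : R) : (0 < n)%N -> 0 <= u <= 2 * n%:R * h ->
  exists2 j, (j < n)%N & 2 * j%:R * h <= u <= 2 * j%:R * h + 2 * h.
Proof.
elim: n => // n IH _ /andP[u0 un].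
have e : n.+1%:R = n%:R + 1 :> R by rewrite natr1.
rewrite e in un.
have [un'|/ltW nu] := leP u (2 * n%:R * h); last first.
  by exists n => //; apply/andP; split; lra.
case: n => [|n] in IH e un un' *.
  exists 0 => //; apply/andP; split; lra.
have [|j jn ju] := IH isT; first by rewrite u0.
by exists j => //; exact: ltnW.
Qed.

(** At height [y] the centres of the two traces differ by [alpha - beta - y * h], so the traces
    nearly coincide once [alpha - beta] is close to [y * h]. *)
Definition halves (alpha beta x h : R) : seq (brick R) :=
  [:: (alpha, x - h / 2, h / 2); (beta, x + h / 2, h / 2)].

Lemma refines_grid sigma alpha beta b n : 0 < hwid b -> (0 < n)%N ->
  A alpha -> A beta -> `|alpha - lab b| <= sigma -> `|beta - lab b| <= sigma ->
  let h := hwid b / n%:R in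
  refines sigma [:: b] (flatten
    [seq halves alpha beta (mid b - hwid b + 2 * j%:R * h + h) h | j <- iota 0 n]).
Proof.
case: b => -[a m] w /= w0 n0 Aa Ab aa ba.
have nn0 : (0 : R) < n%:R by rewrite ltr0n.
set h := w / n%:R.
have h0 : 0 < h by rewrite divr_gt0.
have nh : n%:R * h = w by rewrite /h mulrC divfK// gt_eqF.
split.
- move=> b' /flatten_mapP[j]; rewrite mem_iota add0n => /andP[_ jn].
  have j0 : (0 : R) <= j%:R by [].
  have jn' : (j%:R + 1 : R) <= n%:R by rewrite natr1 ler_nat.
  have jh : 0 <= j%:R * h by rewrite mulr_ge0// ltW.
  have jnh : (j%:R + 1) * h <= w by rewrite -nh ler_wpM2r// ltW.
  have inside x : - w + h / 2 <= x - m <= w - h / 2 -> `|x - m| + h / 2 <= w.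
    by move=> ?; rewrite -lerBrDr ler_norml; lra.
  rewrite !inE => /orP[/eqP ->|/eqP ->] /=; split => //; try lra;
    by exists (a, m, w); rewrite ?inE//=; split => //; apply: inside; lra.
- move=> s [b]; rewrite inE => /eqP -> /=; rewrite ler_norml => sm.
  have [|j jn ju] := @grid_cover n h (s - m + w) n0.
    by rewrite -mulrA nh; lra.
  set x := m - w + 2 * j%:R * h + h.
  have mem b' : b' \in halves alpha beta x h -> b' \in flatten
      [seq halves alpha beta (m - w + 2 * j0%:R * h + h) h | j0 <- iota 0 n].
    by move=> b'h; apply/flatten_mapP; exists j; rewrite // mem_iota.
  have [sx|xs] := leP s x.
    exists (alpha, x - h / 2, h / 2); first by apply: mem; rewrite inE eqxx.
    by rewrite /= ler_norml; rewrite /x in sx *; lra.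
  exists (beta, x + h / 2, h / 2); first by apply: mem; rewrite !inE eqxx orbT.
  by rewrite /= ler_norml; rewrite /x in xs *; lra.
- rewrite /width big_flatten big_map /= big_seq1 /=.
  rewrite (eq_bigr (fun=> h)); last first.
    by move=> j _; rewrite !big_cons big_nil /=; lra.
  by rewrite big_const_seq count_predT size_iota iter_addr_0 -mulr_natl nh.
Qed.

(** The density bound is asked on every interval, which lets a second refinement be controlled in
    the gaps of a first one; [delta] is fixed before the error [tau]. *)
Definition thin B y0 delta c := forall b tau, A (lab b) -> 0 < hwid b -> 0 < tau ->
  exists2 K, refines tau [:: b] K & forall y L, `|y - y0| <= delta * `|y0| ->
    is_interval L -> len B (L `&` shadow y K) <= c * len B (L `&` trace y b) + tau.

Lemma thin1 B y0 delta : thin B y0 delta 1.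
Proof.
move=> b tau Ab b0 tau0; exists [:: b].
  by apply: refines_refl; [exact: ltW|move=> b'; rewrite inE => /eqP ->].
by move=> y L _ _; rewrite shadow1 mul1r lerDl ltW.
Qed.

Lemma thin_le B y0 delta c c' : c <= c' -> thin B y0 delta c -> thin B y0 delta c'.
Proof.
move=> cc' tc b tau Ab b0 tau0; have [K bK HK] := tc b tau Ab b0 tau0.
exists K => // y L yy0 iL; apply: le_trans (HK _ _ yy0 iL) _.
by rewrite lerD2r ler_wpM2r// len_ge0.
Qed.

(* The second brick is refined at a scale so fine that its shadow is spread
   evenly over the gaps left by the shadow of the first one. *)
Lemma thin_pair B y0 delta c b1 b2 tau : 0 <= c <= 1 -> thin B y0 delta c ->
  A (lab b1) -> 0 < hwid b1 -> A (lab b2) -> 0 < hwid b2 -> 0 < tau ->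
  exists2 K, refines tau [:: b1; b2] K & forall y z r L, `|y - y0| <= delta * `|y0| ->
    is_interval L -> trace y b1 `<=` cball z r -> trace y b2 `<=` cball z r ->
    len B (L `&` shadow y K) <= (2 * c - c ^+ 2) * len B (L `&` cball z r) + tau.
Proof.
move=> /andP[c0 c1] tc A1 w1 A2 w2 tau0.
have t10 : 0 < tau / 6 by lra.
have [K1 ref1 len1] := tc b1 _ A1 w1 t10.
have pow0 : (0 : R) < 2 ^+ size K1 by rewrite exprn_gt0.
have pow1 : (1 : R) <= 2 ^+ size K1 by rewrite exprn_ege1//; lra.
(* The error for the second brick is fixed only once [K1] is known, since it is paid on each of up
   to [2 ^+ size K1] gaps. *)
pose t2 := tau / 2 / 2 ^+ size K1.
have t20 : 0 < t2 by rewrite !divr_gt0.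
have t2E : 2 ^+ size K1 * t2 = tau / 2 by rewrite /t2 mulrC divfK// gt_eqF.
have t2le : t2 <= tau by have := ler_wpM2r (ltW t20) pow1; lra.
have [K2 ref2 len2] := tc b2 _ A2 w2 t20.
exists (K1 ++ K2).
  apply: (refines_cat _ [:: b1] [:: b2]).
    by apply: refines_le ref1; lra.
  exact: refines_le ref2.
move=> y z r L yy0 iL t1 t2'.
have {}len1 I : is_interval I ->
    len B (I `&` shadow y K1) <= c * len B (I `&` cball z r) + tau / 6.
  move=> iI; apply: le_trans (len1 _ _ yy0 iI) _.
  have mI := is_interval_measurable iI.
  rewrite lerD2r ler_wpM2l// le_len//; last exact: setIS.
  + by apply: measurableI => //; exact: measurable_trace.
  + by apply: measurableI => //; exact: measurable_cball.
have {}len2 I : is_interval I ->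
    len B (I `&` shadow y K2) <= c * len B (I `&` cball z r) + t2.
  move=> iI; apply: le_trans (len2 _ _ yy0 iI) _.
  have mI := is_interval_measurable iI.
  rewrite lerD2r ler_wpM2l// le_len//; last exact: setIS.
  + by apply: measurableI => //; exact: measurable_trace.
  + by apply: measurableI => //; exact: measurable_cball.
have mL := is_interval_measurable iL.
have mS1 := measurable_shadow y K1.
have mS2 := measurable_shadow y K2.
have mJ := measurable_cball z r.
set S1 := shadow y K1 in mS1 len1 *; set S2 := shadow y K2 in mS2 len2 *.
have gap2 := len_setD_balls _ _ _ _ _
  [seq (lab b + y * mid b, `|y| * hwid b) | b <- K1] _ mS2 mJ len2 iL.
rewrite -/(shadow y K1) -/S1 size_map t2E in gap2.
(* Off the ball the main term vanishes, so [S1] leaks out of the ball by at most two errors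
   [tau / 6]. *)
have gap1 := len_setD_balls _ _ _ _ _ [:: (z, r)] _ mS1 mJ len1 iL.
rewrite balls_cons balls_nil setU0 /= expr1 in gap1.
have e0 : L `&` cball z r `\` cball z r = set0.
  by rewrite -subset0 => x [[_ ?] ?].
rewrite e0 len_set0 in gap1.
have e1 : len B (L `&` S1) = len B (L `&` cball z r `&` S1) + len B (L `&` S1 `\` cball z r).
  rewrite (@lenID _ B (L `&` S1) (cball z r))//; last exact: measurableI.
  by rewrite setIAC.
have e2 : len B (L `&` cball z r) =
    len B (L `&` cball z r `&` S1) + len B (L `&` cball z r `\` S1).
  by apply: lenID => //; exact: measurableI.
have up : len B (L `&` (S1 `|` S2)) <= len B (L `&` S1) + len B (L `&` S2 `\` S1).
  apply: le_trans (lenU _ _ _ _ _).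
  - apply: le_len.
    + by apply: measurableI => //; exact: measurableU.
    + apply: measurableU; first exact: measurableI.
      by apply: measurableD => //; exact: measurableI.
    + move=> x [Lx S12x]; have [S1x|nS1x] := pselect (S1 x); first by left.
      by right; split => //; case: S12x.
  - exact: measurableI.
  - by apply: measurableD => //; exact: measurableI.
rewrite shadow_cat -/S1 -/S2; apply: le_trans up _.
(* With s and l the lengths of [S1] and of the ball within [L], the bound is s + c (l - s) = (1 - c)
   s + c l up to errors; since s <= c l up to errors, this gives (2 c - c^2) l. *)
have cS1 : (1 - c) * len B (L `&` S1) <= (1 - c) * (c * len B (L `&` cball z r) + tau / 6).
  by rewrite ler_wpM2l ?len1//; lra.
have ce : c * len B (L `&` S1 `\` cball z r) <= c * (2 * (tau / 6)).
  by rewrite ler_wpM2l//; lra.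
have ct : c * tau <= tau by rewrite ler_piMl// ltW.
have e3 : c * len B (L `&` cball z r `\` S1) = c * len B (L `&` cball z r)
    - c * len B (L `&` S1) + c * len B (L `&` S1 `\` cball z r).
  by rewrite e1 {1}e2; ring.
rewrite expr2; lra.
Qed.

End Bricks.

(** * Lowering the density by matching labels with slopes *)

Section Thin.
Context {R : realType} (A : set R).
Context (A_limit : forall a e, A a -> 0 < e ->
  exists2 a', A a' & 0 < `|a' - a| <= e).
Implicit Types (L : set R) (B y s c tau : R) (b : brick R) (K : seq (brick R)).

Lemma sub_cball (z z' r r' : R) : `|z - z'| + r <= r' -> cball z r `<=` cball z' r'.
Proof.
by move=> zr x; rewrite /cball /= => xz; have := ler_distD z x z'; lra.
Qed.

(** The added part lies in two balls of radius [s / 2], one on each side. *)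
Lemma len_cball_widen B (X : set R) (z r s : R) : measurable X -> 0 <= s ->
  len B (X `&` cball z (r + s)) <= len B (X `&` cball z r) + 2 * s.
Proof.
move=> mX s0; rewrite (@lenID _ B _ (cball z r)); last 2 first.
- by apply: measurableI => //; exact: measurable_cball.
- exact: measurable_cball.
apply: lerD.
  apply: le_len; last by move=> x [[? _] ?].
  - by apply: measurableI => //; [apply: measurableI => //|]; exact: measurable_cball.
  - by apply: measurableI => //; exact: measurable_cball.
have mc := @measurable_cball R.
apply: (@le_trans _ _
  (len B (cball (z - r - s / 2) (s / 2) `|` cball (z + r + s / 2) (s / 2)))).
  apply: le_len.
  - by apply: measurableD => //; apply: measurableI.
  - exact: measurableU.
  - move=> x [[_]]; rewrite /cball /= => xrs /negP; rewrite -ltNge => xr.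
    have [xz|zx] := leP x z.
      left; move: xr xrs; rewrite ler0_norm ?subr_le0// ler_norml; lra.
    right; move: xr xrs; rewrite gtr0_norm ?subr_gt0// ler_norml; lra.
apply: le_trans (lenU _ _ _ _ _) _ => //.
have s20 : 0 <= s / 2 by lra.
have := len_cball_le B (z - r - s / 2) (s / 2) s20.
have := len_cball_le B (z + r + s / 2) (s / 2) s20.
lra.
Qed.

(** One of the two labels is [a], the other a nearby point of [A]; their order is chosen to give
    [alpha - beta] the sign of [y0]. *)
Lemma label_pair a y0 e : A a -> y0 != 0 -> 0 < e -> exists alpha beta D,
  [/\ A alpha, A beta, `|alpha - a| <= D, `|beta - a| <= D &
      (alpha - beta) * y0 = D * `|y0| /\ 0 < D <= e].
Proof.
move=> Aa y00 e0; have [a' Aa' aa'] := A_limit _ _ Aa e0.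
have D0 : `|a - a| <= `|a' - a| by rewrite subrr normr0.
have [h|h] := leP 0 ((a' - a) * y0).
  exists a', a, `|a' - a|; split => //; split => //.
  by rewrite -normrM ger0_norm.
exists a, a', `|a' - a|; split => //; split => //.
by rewrite -normrM ltr0_norm//; ring.
Qed.

Lemma shadow_sub y tau b K : refines A tau [:: b] K ->
  shadow y K `<=` cball (lab b + y * mid b) (`|y| * hwid b + tau).
Proof.
move=> [e _ _] x /shadowP[b' /e[_ _ [b0]]]; rewrite inE => /eqP -> [ll mm] xb.
apply: sub_cball xb.
have -> : lab b' + y * mid b' - (lab b + y * mid b) =
  lab b' - lab b + y * (mid b' - mid b) by ring.
have h1 := ler_normD (lab b' - lab b) (y * (mid b' - mid b)).
have h2 : `|y| * (`|mid b' - mid b| + hwid b') <= `|y| * hwid b by rewrite ler_wpM2l.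
rewrite normrM in h1; lra.
Qed.

(* Cutting a brick of half-width w into n pieces whose common half-width h makes
   the displacement of labels alpha - beta match the displacement y0 h of the
   traces of the two halves of a piece. *)
Lemma matching_grid a w y0 delta e : A a -> 0 < w -> y0 != 0 -> 0 < delta <= 1 ->
  0 < e -> exists alpha beta D n, let h := w / n%:R in
  [/\ [/\ A alpha, A beta, `|alpha - a| <= D & `|beta - a| <= D],
      (0 < n)%N, 0 < D <= e, h * `|y0| <= 2 * D &
      `|alpha - beta - y0 * h| <= delta * (h * `|y0|)].
Proof.
move=> Aa w0 y00 /andP[d0 d1] e0.
have ny0 : 0 < `|y0| by rewrite normr_gt0.
have wy : 0 < w * `|y0| by rewrite mulr_gt0.
(* The second bound makes [D] so small against the brick that rounding the number of pieces to an
   integer costs only a relative error [delta]. *)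
have e'0 : 0 < Num.min e (delta * (w * `|y0|)) by rewrite lt_min e0 mulr_gt0.
have [al [be [D [Aal Abe ala bea [abD /andP[D0]]]]]] := label_pair _ _ _ Aa y00 e'0.
rewrite le_min => /andP[De Dw].
(* The integer part gives D <= h |y0| <= 2 D. *)
pose n := Num.truncn (w * `|y0| / D).
have nle : n%:R * D <= w * `|y0|.
  by rewrite -ler_pdivlMr// truncn_le// divr_ge0// ltW.
have nlt : w * `|y0| < (n%:R + 1) * D.
  by rewrite -ltr_pdivrMr// natr1 truncnS_gt.
have n0 : (0 < n)%N.
  rewrite lt0n; apply/negP => /eqP n0; move: nlt; rewrite n0 add0r mul1r ltNge.
  by move=> /negP; apply; apply: le_trans Dw _; rewrite ler_piMl// ltW.
have nn0 : (0 : R) < n%:R by rewrite ltr0n.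
have nn1 : (1 : R) <= n%:R by rewrite ler1n.
exists al, be, D, n; set h := w / n%:R.
have nh : n%:R * h = w by rewrite /h mulrC divfK// gt_eqF.
have Dh : D <= h * `|y0| by rewrite -(ler_pM2l nn0) mulrA nh.
have hD : h * `|y0| - D <= delta * (h * `|y0|).
  rewrite -(ler_pM2l nn0).
  have -> : n%:R * (h * `|y0| - D) = w * `|y0| - n%:R * D by rewrite -nh; ring.
  have -> : n%:R * (delta * (h * `|y0|)) = delta * (w * `|y0|) by rewrite -nh; ring.
  clear - nlt Dw; lra.
split => //; first by rewrite D0.
  rewrite -(ler_pM2l nn0) mulrA nh.
  have : D <= n%:R * D by rewrite ler_peMl// ltW.
  clear - nlt; lra.
rewrite -(ler_pM2r ny0) -normrM.
have -> : (al - be - y0 * h) * y0 = `|y0| * (D - h * `|y0|).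
  have -> : (al - be - y0 * h) * y0 = (al - be) * y0 - h * y0 ^+ 2 by ring.
  by rewrite abD -real_normK ?num_real//; ring.
rewrite normrM normr_id mulrC ler_wpM2r// ler0_norm; last by clear - Dh; lra.
by rewrite opprB.
Qed.

(** Here [e] stands for the difference of two labels. The mismatch at [y0] and the move from [y0] to
    [y] each cost [delta] relative to [y0]; as [delta] is at most 1/8, |y0| <= 2 |y|, which doubles
    the constant. *)
Lemma near_scale (y y0 delta e h : R) : 0 < h -> y0 != 0 -> 0 < delta <= 8^-1 ->
  `|y - y0| <= delta * `|y0| -> `|e - y0 * h| <= delta * (h * `|y0|) ->
  [/\ 0 < `|y * h|, `|y * h| <= 2 * (h * `|y0|) &
      `|e - y * h| <= `|y * h| * (4 * delta)].
Proof.
move=> h0 y00 /andP[d0 d8] yy0 eh.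
have ny0 : 0 < `|y0| by rewrite normr_gt0.
have dy : delta * `|y0| <= 8^-1 * `|y0| by rewrite ler_wpM2r// ltW.
have yub : `|y| <= 2 * `|y0|.
  have := ler_normD (y - y0) y0; rewrite subrK.
  clear - dy yy0 ny0; lra.
have ylb : `|y0| <= 2 * `|y|.
  have := ler_normD (y0 - y) y; rewrite subrK distrC.
  clear - dy yy0 ny0; lra.
rewrite normrM (gtr0_norm h0); split.
- by rewrite mulr_gt0//; clear - ny0 ylb; lra.
- by rewrite mulrA (mulrC 2) -mulrA mulrC ler_wpM2l// ltW.
have := ler_normD (e - y0 * h) ((y0 - y) * h).
have -> : e - y0 * h + (y0 - y) * h = e - y * h by ring.
rewrite normrM (gtr0_norm h0) (distrC y0) => h1.
have h2 : `|y - y0| * h <= delta * `|y0| * h by rewrite ler_wpM2r// ltW.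
have h3 : delta * (`|y0| * h) <= delta * (2 * `|y| * h).
  by rewrite ler_wpM2l ?ler_wpM2r// ltW.
clear - h1 h2 h3 eh; lra.
Qed.

Lemma sum_iota_len_cball B L n (z w r : R) : is_interval L -> 0 <= r -> r <= `|w| ->
  0 < `|w| -> \sum_(j <- iota 0 n) len B (L `&` cball (z + 2 * j%:R * w) r)
    <= r / `|w| * len B L + 2 * r.
Proof.
rewrite normr_gt0 => iL r0 rw w0; have := sum_len_cball B L n z w r iL r0 rw w0.
by rewrite -(big_mkord xpredT (fun j => len B (L `&` cball (z + 2 * j%:R * w) r)))
  /index_iota subn0.
Qed.

(** The two halves of a piece have traces in one ball of radius (1/2 + 4 delta) |y h|. The centres
    of these balls are 2 |y h| apart, so they fill a fraction 1/2 + 4 delta, and [thin_pair] gives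
    density 2 c - c^2 inside each. *)
Lemma thin_step B y0 delta c : y0 != 0 -> 0 < delta <= 8^-1 -> 0 <= c <= 1 ->
  thin A B y0 delta c -> thin A B y0 delta ((2 * c - c ^+ 2) * (2^-1 + 4 * delta)).
Proof.
move=> y00 d8 c01 tc [[a m] w] tau /= Aa w0 tau0.
have d1 : 0 < delta <= 1 by clear - d8; lra.
(* This bounds [D], and with it the label shift, the piece size h |y0| <= 2 D and the boundary error
   [2 * rho]. *)
have e0 : 0 < tau / 100 by rewrite divr_gt0.
have [al [be [D [n []]]]] := matching_grid _ _ _ _ _ Aa w0 y00 d1 e0.
set h := w / n%:R => -[Aal Abe ala bea] n0 /andP[D0 Dtau] h2D eyh.
have nn0 : (0 : R) < n%:R by rewrite ltr0n.
have nn1 : (1 : R) <= n%:R by rewrite ler1n.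
have h0 : 0 < h by rewrite divr_gt0.
(* The error [t] occurs once for each of the [n] pieces. *)
pose t := tau / 10 / n%:R.
have t0 : 0 < t by rewrite !divr_gt0.
have nt : n%:R * t = tau / 10 by rewrite /t mulrC divfK// gt_eqF.
have tle : t <= tau / 10 by rewrite -nt ler_peMl// ltW.
pose x j := m - w + 2 * j%:R * h + h.
have h20 : 0 < h / 2 by rewrite divr_gt0.
have /choice[F FP] : forall j : nat, exists K,
    refines A t (halves al be (x j) h) K /\ forall y z r L, `|y - y0| <= delta * `|y0| ->
    is_interval L -> trace y (al, x j - h / 2, h / 2) `<=` cball z r ->
    trace y (be, x j + h / 2, h / 2) `<=` cball z r ->
    len B (L `&` shadow y K) <= (2 * c - c ^+ 2) * len B (L `&` cball z r) + t.
  move=> j; have [K rK lK] := thin_pair _ _ _ _ _ (al, x j - h / 2, h / 2)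
    (be, x j + h / 2, h / 2) _ c01 tc Aal h20 Abe h20 t0.
  by exists K.
pose K := flatten [seq F j | j <- iota 0 n].
have refK : refines A (D + t) [:: (a, m, w)] K.
  apply: refines_trans.
    by apply: (refines_grid _ _ al be _ n); rewrite //=.
  by apply: refines_flatten => j _; have [] := FP j.
exists K; first by apply: refines_le refK; clear - Dtau tle tau0; lra.
move=> y L yy0 iL.
have [om0 omD near] := near_scale _ _ _ _ _ h0 y00 d8 yy0 eyh.
set om := y * h in om0 omD near.
have omE : `|om| = `|y| * h by rewrite /om normrM (gtr0_norm h0).
(* The ball shares its centre with the trace of the left half; its radius is that of the trace, |y|
   h / 2, plus the bound on the mismatch of the two centres. *)
pose rho := `|om| * (2^-1 + 4 * delta).
have d20 : 0 <= 2^-1 + 4 * delta by clear - d8; lra.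
have d21 : 2^-1 + 4 * delta <= 1 by clear - d8; lra.
have rho0 : 0 <= rho by rewrite mulr_ge0.
have rho1 : rho <= `|om| by rewrite ler_piMr.
have rhoE : rho / `|om| = 2^-1 + 4 * delta by rewrite /rho mulrC mulKf// gt_eqF.
have rhoh : `|y| * (h / 2) + `|om| * (4 * delta) <= rho.
  by rewrite /rho omE; clear; lra.
pose z := al + y * (m - w + h / 2).
have lenF j I : is_interval I -> len B (I `&` shadow y (F j)) <=
    (2 * c - c ^+ 2) * len B (I `&` cball (z + 2 * j%:R * om) rho) + t.
  move=> iI; have [_ FPj] := FP j; apply: FPj => //; apply: sub_cball => /=.
    rewrite (_ : _ - _ = 0); last by rewrite /z /om /x; field.
    rewrite normr0 add0r; apply: le_trans rhoh.
    by rewrite lerDl mulr_ge0// mulr_ge0//; clear - d8; lra.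
  rewrite (_ : _ - _ = - (al - be - om)); last by rewrite /z /om /x; field.
  by rewrite normrN addrC; apply: le_trans rhoh; rewrite lerD2l.
(* The shadow lies in the trace of the brick widened by [D + t], so [L] can be cut down to that
   ball, and the fraction is taken of the trace rather than of [L]. *)
have sub := shadow_sub y _ _ _ refK.
rewrite /= in sub; set J := cball _ _ in sub.
have mL := is_interval_measurable iL.
have -> : L `&` shadow y K = (L `&` J) `&` shadow y K.
  by rewrite -setIA (setIidr sub).
have iL' : is_interval (L `&` J) by apply: is_intervalI => //; exact: is_interval_cball.
have mL' := is_interval_measurable iL'.
apply: le_trans (len_shadow_flatten _ _ _ _ _ _ mL') _.
apply: (@le_trans _ _ (\sum_(j <- iota 0 n) ((2 * c - c ^+ 2) *
    len B (L `&` J `&` cball (z + 2 * j%:R * om) rho) + t))).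
  by apply: ler_sum => j _; exact: lenF.
rewrite big_split /= -mulr_sumr big_const_seq count_predT size_iota iter_addr_0.
rewrite -[t *+ n]mulr_natl nt.
have := sum_iota_len_cball B (L `&` J) n z om rho iL' rho0 rho1 om0.
rewrite rhoE; set Sm := \sum_(j <- iota 0 n) _ => HS.
have Dt0 : 0 <= D + t by rewrite addr_ge0// ltW.
have HJ : len B (L `&` J) <= len B (L `&` trace y (a, m, w)) + 2 * (D + t).
  exact: len_cball_widen.
have [c0 c1] := andP c01.
have cc0 : 0 <= 2 * c - c ^+ 2.
  have -> : 2 * c - c ^+ 2 = c * (2 - c) by ring.
  by rewrite mulr_ge0//; clear - c1; lra.
have cc1 : 2 * c - c ^+ 2 <= 1.
  have -> : 2 * c - c ^+ 2 = 1 - (1 - c) ^+ 2 by ring.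
  by rewrite lerBlDr lerDl sqr_ge0.
have HJ' := ler_wpM2l d20 HJ.
have HD : (2^-1 + 4 * delta) * (2 * (D + t)) <= 2 * (D + t).
  by rewrite ler_piMl// mulr_ge0.
have HS2 : Sm <= (2^-1 + 4 * delta) * len B (L `&` trace y (a, m, w)) +
    (2 * (D + t) + 2 * rho).
  clear - HS HJ' HD; lra.
have HS3 := ler_wpM2l cc0 HS2.
have HS4 : (2 * c - c ^+ 2) * (2 * (D + t) + 2 * rho) <= 2 * (D + t) + 2 * rho.
  by rewrite ler_piMl// addr_ge0// mulr_ge0.
clear - HS3 HS4 tle Dtau tau0 omD h2D rho1 D0 t0.
move: (2 * c - c ^+ 2) (2^-1 + 4 * delta) (len B _) HS3 HS4 => u v l; lra.
Qed.

(** While c >= eps, one step with delta = eps^2 / 16 leads to at most c - c^2 / 2 + eps^2 / 4 <= c -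
    eps^2 / 4, so about 4 / eps^2 steps suffice, all with the same delta. *)
Lemma thin_small B y0 eps : y0 != 0 -> 0 < eps <= 1 -> thin A B y0 (eps ^+ 2 / 16) eps.
Proof.
move=> y00 /andP[e0 e1].
have ee0 : 0 < eps ^+ 2 by rewrite exprn_gt0.
have ee1 : eps ^+ 2 <= 1 by rewrite exprn_ile1// ltW.
suff H n : thin A B y0 (eps ^+ 2 / 16) (Num.max eps (1 - n%:R * (eps ^+ 2 / 4))).
  have := H (Num.truncn (4 / eps ^+ 2)).+1; rewrite max_l//.
  have := truncnS_gt (4 / eps ^+ 2); rewrite ltr_pdivrMr//.
  lra.
elim: n => [|n IH]; first by rewrite mul0r subr0 max_r//; exact: thin1.
set c := Num.max _ _ in IH.
have ce : eps <= c by rewrite le_max lexx.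
have cn : 1 - n%:R * (eps ^+ 2 / 4) <= c by rewrite le_max lexx orbT.
have c1 : c <= 1.
  have : 0 <= n%:R * (eps ^+ 2 / 4) by rewrite mulr_ge0// divr_ge0// ltW.
  by rewrite ge_max e1 /=; lra.
have -> : n.+1%:R = n%:R + 1 :> R by rewrite natr1.
have [ceq|ceq] := leP (1 - n%:R * (eps ^+ 2 / 4)) eps.
  rewrite max_l; last by lra.
  by move: IH; rewrite /c max_l.
have cE : c = 1 - n%:R * (eps ^+ 2 / 4) by rewrite /c max_r// ltW.
apply: thin_le (thin_step _ _ _ _ y00 _ _ IH); last 2 first.
- by apply/andP; split; lra.
- by apply/andP; split; lra.
rewrite le_max; apply/orP; right.
have sq : 2 * c - c ^+ 2 <= 1 by have := sqr_ge0 (1 - c); lra.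
have ec : eps ^+ 2 <= c ^+ 2 by rewrite ler_sqr ?nnegrE; lra.
have : (2 * c - c ^+ 2) * (4 * (eps ^+ 2 / 16)) <= 4 * (eps ^+ 2 / 16).
  by rewrite ler_piMl//; lra.
lra.
Qed.

(** Room for labels that may still move by up to [rho] in later refinements. *)
Definition fat rho y K : set R :=
  balls [seq (lab b + y * mid b, `|y| * hwid b + rho) | b <- K].

Lemma len_fat B rho y K : 0 <= rho ->
  len B (fat rho y K) <= len B (shadow y K) + (size K)%:R * (2 * rho).
Proof.
(* The set [X] is arbitrary because the induction removes the first ball from it. *)
move=> rho0; suff H (X : set R) : measurable X -> len B (X `&` fat rho y K) <=
    len B (X `&` shadow y K) + (size K)%:R * (2 * rho).
  by have := H setT measurableT; rewrite !setTI.
elim: K X => [|b K IH] X mX.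
  by rewrite /fat /shadow /= !balls_nil !setI0 mul0r addr0.
have mf b' := @measurable_cball R (lab b' + y * mid b').
rewrite /fat /shadow /= !balls_cons /= -/(fat rho y K) -/(shadow y K).
set C := cball _ (`|y| * _ + rho); set C' := cball _ (`|y| * _).
have mfK : measurable (fat rho y K) by exact: measurable_balls.
have msK := measurable_shadow y K.
have mC : measurable C by exact: mf.
have mC' : measurable C' by exact: mf.
have CC' : C' `<=` C by apply: sub_cball; rewrite subrr normr0 add0r; lra.
rewrite [leLHS](@lenID _ B _ C'); last 2 first.
- by apply: measurableI => //; exact: measurableU.
- by [].
rewrite [len B (X `&` (C' `|` _))](@lenID _ B _ C'); last 2 first.
- by apply: measurableI => //; exact: measurableU.
- by [].
have e1 : len B (X `&` (C `|` fat rho y K) `&` C') <=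
    len B (X `&` (C' `|` shadow y K) `&` C').
  apply: le_len.
  - by apply: measurableI => //; apply: measurableI => //; exact: measurableU.
  - by apply: measurableI => //; apply: measurableI => //; exact: measurableU.
  - by move=> u [[Xu _] C'u]; split => //; split => //; left.
have e2 : len B (X `&` (C `|` fat rho y K) `\` C') <=
    len B ((X `\` C') `&` C) + len B ((X `\` C') `&` fat rho y K).
  apply: le_trans (lenU _ _ _ _ _).
  - apply: le_len.
    + by apply: measurableD => //; apply: measurableI => //; exact: measurableU.
    + by apply: measurableU; apply: measurableI => //; exact: measurableD.
    + by move=> u [[Xu [?|?]] ?]; [left|right].
  - by apply: measurableI => //; exact: measurableD.
  - by apply: measurableI => //; exact: measurableD.
have mXC : measurable (X `\` C') by exact: measurableD.
have := len_cball_widen B _ (lab b + y * mid b) (`|y| * hwid b) rho mXC rho0.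
rewrite -/C -/C' (_ : (X `\` C') `&` C' = set0); last by rewrite -subset0 => u [[]].
rewrite len_set0 => e3.
have e4 := IH _ mXC.
have e5 : len B ((X `\` C') `&` shadow y K) <= len B (X `&` (C' `|` shadow y K) `\` C').
  apply: le_len.
  - exact: measurableI.
  - by apply: measurableD => //; apply: measurableI => //; exact: measurableU.
  - by move=> u [[Xu nC'] ?]; split => //; split => //; right.
have -> : (size K).+1%:R = (size K)%:R + 1 :> R by rewrite natr1.
lra.
Qed.

(** At most half of the displacement budget [rho] pays for thinning; the rest leaves room for the
    new budget [rho'], chosen after [K'] so that fattening adds little length. *)
Lemma refine_fat K B y0 eps rho :
  (forall b, b \in K -> A (lab b) /\ 0 < hwid b) ->
  y0 != 0 -> 0 < eps <= 1 -> 0 < rho ->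
  exists K' rho', [/\ 0 < rho', refines A (rho - rho') K K' &
    forall y, `|y - y0| <= eps ^+ 2 / 16 * `|y0| ->
      len B (fat rho' y K') <= eps * (2 * `|y| * width K + 1)].
Proof.
move=> wfK y00 eps01 rho0; have [e0 e1] := andP eps01.
pose t := Num.min (rho / 2) (eps / 2 / (size K).+1%:R).
have t0 : 0 < t by rewrite lt_min; apply/andP; split; [lra|rewrite !divr_gt0].
have trho : t <= rho / 2 by rewrite ge_min lexx.
have Kt : (size K)%:R * t <= eps / 2.
  apply: (@le_trans _ _ ((size K).+1%:R * t)).
    by rewrite ler_wpM2r ?ler_nat// ltW.
  by rewrite mulrC -ler_pdivlMr// ge_min lexx orbT.
have /choice[F FP] : forall b, exists K', A (lab b) -> 0 < hwid b ->
    refines A t [:: b] K' /\ forall y, `|y - y0| <= eps ^+ 2 / 16 * `|y0| ->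
    len B (shadow y K') <= eps * (2 * (`|y| * hwid b)) + t.
  move=> b; have [Ab|nA] := pselect (A (lab b)); last by exists [::].
  have [b0|nb] := pselect (0 < hwid b); last by exists [::].
  have [K' rK' lK'] := thin_small B _ _ y00 eps01 _ _ Ab b0 t0.
  exists K' => _ _; split => // y yy0.
  have := lK' y setT yy0 (fun _ _ _ _ _ _ => I); rewrite !setTI.
  move=> /le_trans; apply; rewrite lerD2r ler_wpM2l//; first exact: ltW.
  by apply: len_cball_le; rewrite mulr_ge0// ltW.
pose K' := flatten [seq F b | b <- K].
pose r := Num.min (rho / 2) (eps / 4 / (size K').+1%:R).
have r0 : 0 < r by rewrite lt_min; apply/andP; split; [lra|rewrite !divr_gt0].
have rrho : r <= rho / 2 by rewrite ge_min lexx.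
have Kr : (size K')%:R * r <= eps / 4.
  apply: (@le_trans _ _ ((size K').+1%:R * r)).
    by rewrite ler_wpM2r ?ler_nat// ltW.
  by rewrite mulrC -ler_pdivlMr// ge_min lexx orbT.
have refK : refines A t K K'.
  have {1}-> : K = flatten [seq [:: b] | b <- K] by rewrite flatten_seq1.
  apply: refines_flatten => b /wfK[Ab b0]; by have [] := FP _ Ab b0.
exists K', r; split => //; first by apply: refines_le refK; lra.
move=> y yy0; apply: le_trans (len_fat _ _ _ _ (ltW r0)) _.
have := len_shadow_flatten _ B y setT F K measurableT.
rewrite setTI -/K' => h1.
have h2 : \sum_(b <- K) len B (setT `&` shadow y (F b)) <=
    \sum_(b <- K) (eps * (2 * (`|y| * hwid b)) + t).
  rewrite big_seq [leRHS]big_seq; apply: ler_sum => b /wfK[Ab b0].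
  by rewrite setTI; have [_] := FP _ Ab b0; apply.
rewrite big_split /= -mulr_sumr -mulr_sumr -mulr_sumr in h2.
rewrite big_const_seq count_predT iter_addr_0 -[t *+ _]mulr_natl in h2.
rewrite -/(width K) in h2; lra.
Qed.

End Thin.

(** * Passing to the limit: a closed family of lines whose trace is null at every nonzero height *)

Section Limit.
Context {R : realType} (A : set R).
Context (A_limit : forall a e, A a -> 0 < e ->
  exists2 a', A a' & 0 < `|a' - a| <= e).
Context (A_compact : compact A).
Implicit Types (L : set R) (B y s c tau : R) (b : brick R) (K : seq (brick R)).

Lemma closed_sublevel (T : topologicalType) (f : T -> R) (r : R) :
  continuous f -> closed [set p | f p <= r].
Proof.
move=> cf; rewrite (_ : [set p | _] = f @^-1` [set x | x <= r])//.
by apply: preimage_closed => [p _|]; [exact: cf|exact: closed_le].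
Qed.

Lemma continuous_pair (S T U : topologicalType) (f : S -> T) (g : S -> U) :
  continuous f -> continuous g -> continuous (fun x => (f x, g x)).
Proof.
move=> cf cg x.
exact: (@cvg_pair _ _ _ _ (nbhs (f x)) (nbhs (g x)) _ _ _ f g (cf x) (cg x)).
Qed.

Lemma measurable_ge0_fun d (T : measurableType d) (f : T -> R) :
  measurable_fun setT f -> measurable [set p | 0 <= f p].
Proof.
move=> mf; have := mf measurableT `[0, +oo[%classic (measurable_itv _).
rewrite setTI; congr measurable; apply/seteqP.
by split=> p /=; rewrite in_itv /= andbT.
Qed.

(** A point (a, s) stands for the line x = a + s y. The radius [rho] is the displacement budget left
    for labels, which makes successive tubes nested. *)
Definition tube rho K : set (R * R) :=
  [set p | exists2 b, b \in K & `|p.1 - lab b| <= rho /\ `|p.2 - mid b| <= hwid b].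

Lemma closed_tube rho K : closed (tube rho K).
Proof.
elim: K => [|b K IH].
  by rewrite (_ : tube _ _ = set0); [exact: closed0|apply/seteqP; split=> // p []].
have -> : tube rho (b :: K) = [set p | `|p.1 - lab b| <= rho] `&`
    [set p | `|p.2 - mid b| <= hwid b] `|` tube rho K.
  apply/seteqP; split=> p.
    by case=> b'; rewrite inE => /predU1P[->|b'K] pb; [left|right; exists b'].
  case=> [pb|[b' b'K pb]]; first by exists b; rewrite ?inE ?eqxx.
  by exists b'; rewrite // inE b'K orbT.
apply: closedU => //; apply: closedI; apply: closed_sublevel => p;
  apply: cvg_norm; apply: cvgB; try exact: cvg_cst.
- exact: cvg_fst.
- exact: cvg_snd.
Qed.

Lemma tube_sub_fat rho K a s y : tube rho K (a, s) -> fat rho y K (a + s * y).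
Proof.
move=> [b bK /= [ab sb]]; exists (lab b + y * mid b, `|y| * hwid b + rho).
  exact: (map_f (fun b => (lab b + y * mid b, `|y| * hwid b + rho))).
rewrite /cball /=.
have -> : a + s * y - (lab b + y * mid b) = (a - lab b) + y * (s - mid b) by ring.
have := ler_normD (a - lab b) (y * (s - mid b)); rewrite normrM.
have : `|y| * `|s - mid b| <= `|y| * hwid b by rewrite ler_wpM2l.
lra.
Qed.

Lemma refines_tube rho rho' K K' : refines A (rho - rho') K K' ->
  tube rho' K' `<=` tube rho K.
Proof.
move=> [e _ _] [a s] [b' /e[_ _ [b bK [lb mb]]] /= [ab sb]].
exists b => //=; split.
  by have := ler_distD (lab b') a (lab b); lra.
by have := ler_distD (mid b') s (mid b); lra.
Qed.

Lemma measurable_fat2 rho K :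
  measurable ([set z | fat rho z.2 K z.1] : set (measurableTypeR R * measurableTypeR R)).
Proof.
elim: K => [|b K IH].
  rewrite (_ : [set z | _] = set0); first exact: measurable0.
  by apply/seteqP; split=> // z; rewrite /fat /= balls_nil.
have -> : [set z : R * R | fat rho z.2 (b :: K) z.1] =
    [set z | 0 <= `|z.2| * hwid b + rho - `|z.1 - (lab b + z.2 * mid b)| ] `|`
    [set z | fat rho z.2 K z.1].
  apply/seteqP; split=> z; rewrite /fat /= balls_cons.
    by move=> [zb|?]; [left; rewrite /= subr_ge0|right].
  by move=> [zb|?]; [left; rewrite /= subr_ge0 in zb|right].
apply: measurableU => //; apply: measurable_ge0_fun.
have m1 := @measurable_fst _ _ (measurableTypeR R) (measurableTypeR R).
have m2 := @measurable_snd _ _ (measurableTypeR R) (measurableTypeR R).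
apply: measurable_funB.
  apply: measurable_funD; last exact: measurable_cst.
  apply: measurable_funM; last exact: measurable_cst.
  by apply: measurableT_comp m2; exact: normr_measurable.
apply: measurableT_comp; first exact: normr_measurable.
apply: measurable_funB m1 _; apply: measurable_funD; first exact: measurable_cst.
by apply: measurable_funM m2 _; exact: measurable_cst.
Qed.

(** The product measure integrates vertical sections; uniqueness identifies it with the one that
    integrates horizontal sections. *)
Lemma product_null (N : set (measurableTypeR R * measurableTypeR R)) : measurable N ->
  (forall y, lebesgue_measure (ysection N y) = 0 :> \bar R) ->
  (lebesgue_measure \x lebesgue_measure)%E N = 0 :> \bar R.
Proof.
move=> mN N0; pose mu := [the {sigma_finite_measure set _ -> \bar R} of @lebesgue_measure R].
transitivity ((mu \x^ mu)%E N).
  by apply: product_measure_unique => // X Y mX mY /=; rewrite product_measure2E.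
by apply: integral0_eq => y _; exact: N0.
Qed.

(** As [k] grows the windows increase while the bounds tend to 0, so [X] has length 0 in every
    window. *)
Lemma lebesgue_null_len (X : set R) (C : R) : measurable X ->
  (forall k : nat, len k%:R X <= k.+1%:R^-1 * C) -> lebesgue_measure X = 0 :> \bar R.
Proof.
move=> mX Xk.
have X0 (j : nat) : len j%:R X = 0.
  apply/eqP; rewrite eq_le len_ge0 andbT; apply/ler_addgt0Pr => e e0.
  rewrite add0r.
  have C0 : 0 <= C.
    have := Xk 0%N; rewrite invr1 mul1r; apply: le_trans; exact: len_ge0.
  pose k := maxn j (Num.truncn (C / e)).
  have jk : (j <= k)%N by exact: leq_maxl.
  apply: (@le_trans _ _ (len k%:R X)).
    rewrite -lee_fin -!lenE//; apply: le_measure; rewrite ?inE; try exact: measurableI.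
    apply: setIS => x /=; rewrite !in_itv /=.
    have : (j%:R : R) <= k%:R by rewrite ler_nat.
    lra.
  apply: le_trans (Xk k) _; rewrite mulrC ler_pdivrMr//.
  have : C / e < k.+1%:R.
    apply: lt_le_trans (truncnS_gt _) _.
    by rewrite ler_nat ltnS leq_maxr.
  by rewrite ltr_pdivrMr// => /ltW; rewrite mulrC.
apply: measure_negligible => //.
have -> : X = \bigcup_(j : nat) (X `&` `[- (j%:R : R), j%:R]).
  apply/seteqP; split=> [x Xx|x [j _ []]//].
  exists (Num.truncn `|x|).+1 => //; split => //=; rewrite in_itv /=.
  by rewrite -ler_norml ltW// truncnS_gt.
apply: negligible_bigcup => j; exists (X `&` `[- (j%:R : R), j%:R]); split => //.
  exact: measurableI.
by have := lenE j%:R X mX; rewrite X0.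
Qed.

(** The stages run through all pairs (k, q) of a natural number and a rational, thinning to density
    1 / (k + 1) at heights near q in the window of size k; every y != 0 is close enough to some
    q. *)
Lemma stages K0 : (forall b, b \in K0 -> A (lab b) /\ 0 < hwid b) ->
  exists (K : nat -> seq (brick R)) (rho : nat -> R), [/\ K 0%N = K0, forall n, 0 < rho n,
    forall n, refines A (rho n - rho n.+1) (K n) (K n.+1) &
    forall y k, y != 0 -> exists n : nat,
      len k%:R (fat (rho n) y (K n)) <= k.+1%:R^-1 * (2 * `|y| * width K0 + 1)].
Proof.
move=> wf0.
pose wf (st : seq (brick R) * R) :=
  (forall b, b \in st.1 -> A (lab b) /\ 0 < hwid b) /\ 0 < st.2.
(* Indices that encode no pair get (0, 0), and the inadmissible centre 0 is replaced by 1. *)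
pose code (n : nat) : nat * rat := odflt (0%N, 0) (unpickle n).
pose cen n : R := if (code n).2 == 0 then 1 else ratr (code n).2.
pose eps n : R := (code n).1.+1%:R^-1.
have cen0 n : cen n != 0.
  by rewrite /cen; case: ifPn => [_|]; rewrite ?oner_eq0// fmorph_eq0.
have eps01 n : 0 < eps n <= 1.
  by rewrite invr_gt0 ltr0n /= invf_le1 ?ler1n ?ltr0n.
have /choice[next nextP] : forall i : nat * (seq (brick R) * R), exists st',
    wf i.2 -> [/\ 0 < st'.2, refines A (i.2.2 - st'.2) i.2.1 st'.1 &
    forall y, `|y - cen i.1| <= eps i.1 ^+ 2 / 16 * `|cen i.1| ->
      len (code i.1).1%:R (fat st'.2 y st'.1) <= eps i.1 * (2 * `|y| * width i.2.1 + 1)].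
  move=> [n [K rho]] /=.
  have [[wfK rho0]|nwf] := pselect (wf (K, rho)); last by exists ([::], 0).
  have [K' [rho' [? ? ?]]] := refine_fat A A_limit _ ((code n).1%:R) _ _ _
    wfK (cen0 n) (eps01 n) rho0.
  by exists (K', rho').
pose st := fix st n := if n is m.+1 then next (m, st m) else (K0, 1).
have wfst n : wf (st n).
  elim: n => [|n IH]; first by split => //=.
  have [r0 [e _ _] _] := nextP (n, st n) IH; split => // b bK.
  by have [] := e _ bK.
have stP n := nextP (n, st n) (wfst n).
exists (fun n => (st n).1), (fun n => (st n).2); split => //.
- by move=> n; have [] := wfst n.
- by move=> n; have [] := stP n.
have wK n : width (st n).1 <= width K0.
  by elim: n => [//|n]; apply: le_trans; have [_ []] := stP n.
move=> y k y0.
pose e : R := k.+1%:R^-1.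
have e01 : 0 < e <= 1 by rewrite invr_gt0 ltr0n /= invf_le1 ?ler1n ?ltr0n.
have ny0 : 0 < `|y| by rewrite normr_gt0.
(* The tolerance is relative to |q|; half of it relative to |y| suffices, since |q| >= |y| / 2. *)
pose d := e ^+ 2 / 16 * `|y| / 2.
have ee1 : e ^+ 2 <= 1 by rewrite exprn_ile1//; lra.
have ee0 : 0 < e ^+ 2 by rewrite exprn_gt0//; lra.
have d0 : 0 < d by rewrite /d !divr_gt0// mulr_gt0// divr_gt0.
have dy : d <= `|y| / 32.
  have : e ^+ 2 * `|y| <= `|y| by rewrite ler_piMl// ltW.
  rewrite /d; lra.
have [q] := @rat_in_itvoo R (y - d) (y + d) ltac:(lra).
rewrite in_itv /= => qy.
have qd : `|y - ratr q| <= d by rewrite ler_norml; lra.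
have qlb : `|y| / 2 <= `|ratr q : R|.
  by have := ler_normD (y - ratr q) (ratr q); rewrite subrK; lra.
have q0 : q != 0.
  by apply/eqP => q0; rewrite q0 rmorph0 normr0 in qlb; lra.
(* The pair with code [n] is treated in passing from stage [n] to stage [n.+1]. *)
exists (pickle (k, q)).+1.
set n := pickle (k, q).
have cn : code n = (k, q) by rewrite /code /n pickleK.
have [_ _ /(_ y)] := stP n.
rewrite /= /cen /eps cn /= (negbTE q0) -/e => H.
apply: le_trans (H _) _.
  apply: (le_trans qd); rewrite /d -mulrA ler_wpM2l// ltW//.
  by rewrite divr_gt0.
rewrite ler_wpM2l//; first by rewrite /e; case/andP: e01 => /ltW.
by rewrite lerD2r ler_wpM2l.
Qed.

(** The family is the intersection of all tubes, with labels in [A]. Every slope keeps a label by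
    compactness of [A], and the trace at height y != 0 lies in all the fat shadows. *)
Lemma null_pencil K0 : (forall b, b \in K0 -> A (lab b) /\ 0 < hwid b) ->
  exists P : set (R * R), [/\ closed P, forall p, P p -> A p.1 /\ covers K0 p.2,
    forall s, covers K0 s -> exists a, P (a, s) &
    (lebesgue_measure \x lebesgue_measure)%E.-negligible
      ([set z | z.2 != 0 /\ exists2 p, P p & z.1 = p.1 + p.2 * z.2] :
        set (measurableTypeR R * measurableTypeR R))].
Proof.
move=> wf0; have [K [rho [K0E rho0 refK lenK]]] := stages _ wf0.
have clA : closed A by exact: compact_closed.
pose P : set (R * R) := [set p | A p.1 /\ forall n, tube (rho n) (K n) p].
have nested m n : (m <= n)%N -> tube (rho n) (K n) `<=` tube (rho m) (K m).
  move=> /subnK <-; elim: (n - m)%N => [//|i IH].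
  by rewrite addSn; apply: subset_trans IH; exact: refines_tube.
exists P; split.
- rewrite (_ : P = fst @^-1` A `&` \bigcap_n tube (rho n) (K n)).
    apply: closedI.
      by apply: preimage_closed => // p _; exact: cvg_fst.
    by apply: closed_bigI => n _; exact: closed_tube.
  apply/seteqP; split=> p [Ap Pp]; split => // n.
  exact: (Pp n I).
- move=> p [Ap /(_ 0%N)]; rewrite K0E => -[b bK [_ sb]]; split => //.
  by exists b.
- move=> s s0.
  have cov n : covers (K n) s.
    by elim: n => [|n IH]; [rewrite K0E|have [_ h _] := refK n; exact: h].
  (* For fixed [s] the labels allowed by the tubes form decreasing closed sets; each meets [A] in
     the label of a brick covering [s], so finite intersections are nonempty. *)
  move: A_compact; rewrite compact_In0.
  move=> /(_ nat setT (fun n => A `&` [set a | tube (rho n) (K n) (a, s)])) [].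
  + exists (fun n => [set a | tube (rho n) (K n) (a, s)]) => // n _.
    apply: (@preimage_closed _ _ (fun a : R => (a, s)) (tube (rho n) (K n))).
      by move=> a _; apply: continuous_pair => ?; [exact: cvg_id|exact: cvg_cst].
    exact: closed_tube.
  + move=> D _; pose m := \max_(i <- finmap.enum_fset D) i.
    have [b bK sb] := cov m.
    have Ab : A (lab b).
      case: m bK => [|m] bK; first by rewrite K0E in bK; have [] := wf0 _ bK.
      by have [/(_ _ bK)[]] := refK m.
    exists (lab b) => i iD; split => //=.
    apply: (nested i m).
      by apply: (@leq_bigmax_seq _ _ xpredT id).
    by exists b => //=; rewrite subrr normr0 ltW.
  + by move=> a aP; exists a; split; [have [] := aP 0%N I|move=> n; have [] := aP n I].
- pose N : set (measurableTypeR R * measurableTypeR R) :=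
    [set z | z.2 != 0] `&` \bigcap_n [set z | fat (rho n) z.2 (K n) z.1].
  have mne : measurable ([set z | z.2 != 0] : set (measurableTypeR R * measurableTypeR R)).
    have := @measurable_snd _ _ (measurableTypeR R) (measurableTypeR R) measurableT
      (~` [set 0]) (measurableC (measurable_set1 _)).
    by rewrite setTI; congr measurable; apply/seteqP; split=> z /= /eqP.
  have mN : measurable N.
    by apply: measurableI => //; apply: bigcap_measurable => // n _; exact: measurable_fat2.
  exists N; split => //.
    apply: product_null => // y; have [->|y0] := eqVneq y 0.
      rewrite (_ : ysection _ _ = set0) ?measure0//.
      by rewrite -subset0 => x; rewrite /ysection /= inE => -[] /=; rewrite eqxx.
    apply: (@lebesgue_null_len _ (2 * `|y| * width K0 + 1)).
      exact: measurable_ysection.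
    move=> k; have [n] := lenK y k y0; apply: le_trans.
    apply: le_len.
    + exact: measurable_ysection.
    + exact: measurable_balls.
    + by move=> x; rewrite /ysection /= inE => -[_ /(_ n I)].
  move=> [x y] /= [y0 [[a s] [Aa Pas] /= ->]]; split => // n _ /=.
  exact: tube_sub_fat.
Qed.

End Limit.

(** * Unit segments on the lines, and compactness of pencils *)

Section Segments.
Context {R : realType}.
Implicit Types (P : set (R * R)).

Lemma perfect_limit (A : set R) (a e : R) : perfect_set A -> A a -> 0 < e ->
  exists2 a', A a' & 0 < `|a' - a| <= e.
Proof.
move=> [_ limA]; rewrite -{1}limA => la e0.
have [y [ya Ay ye]] := la (ball a e) (nbhsx_ballx a e e0).
exists y => //; rewrite normr_gt0 subr_eq0 ya /= distrC; exact: ltW.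
Qed.

(* A unit segment centred at (a, 0) on the line x = a + s y consists of the
   points of height y with 4 y^2 (1 + s^2) <= 1. *)
Definition pencil P : set (R * R) :=
  [set z | exists2 p, P p &
     z.1 = p.1 + p.2 * z.2 /\ (2 * z.2) ^+ 2 * (1 + p.2 ^+ 2) <= 1].

Lemma normr_le_half (u : R) : (2 * u) ^+ 2 <= 1 -> `|u| <= 2^-1.
Proof.
move=> u1; rewrite -ler_sqr ?nnegrE ?invr_ge0// real_normK ?num_real//.
by move: u1; rewrite exprMn; lra.
Qed.

(** The numbers [s * y] and [y] are the coordinates of a point of the segment relative to its
    centre. *)
Lemma height_bounds (y s : R) : (2 * y) ^+ 2 * (1 + s ^+ 2) <= 1 ->
  `|y| <= 2^-1 /\ `|s * y| <= 2^-1.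
Proof.
have := sqr_ge0 (2 * y); have := sqr_ge0 (2 * (s * y)).
have -> : (2 * (s * y)) ^+ 2 = (2 * y) ^+ 2 * s ^+ 2 by ring.
by move=> h1 h2 h; split; apply: normr_le_half; lra.
Qed.

(** The pencil is the image of a closed bounded set of parameters ((a, s), y) under the continuous
    map to (a + s y, y). *)
Lemma compact_pencil P (M : R) : closed P ->
  (forall p, P p -> 0 <= p.1 <= 1 /\ `|p.2| <= M) -> compact (pencil P).
Proof.
move=> cP Pb.
pose Q := [set q : (R * R) * R | P q.1 /\ (2 * q.2) ^+ 2 * (1 + q.1.2 ^+ 2) <= 1].
have c12 : continuous (fun q : (R * R) * R => q.1.2).
  by move=> q; apply: (@cvg_comp _ _ _ fst snd); [exact: cvg_fst|exact: cvg_snd].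
have c11 : continuous (fun q : (R * R) * R => q.1.1).
  by move=> q; apply: (@cvg_comp _ _ _ fst fst); exact: cvg_fst.
have c2 : continuous (fun q : (R * R) * R => q.2) by move=> q; exact: cvg_snd.
have cQ : compact Q.
  pose C : set ((R * R) * R) := (`[0, 1] `*` `[- M, M]) `*` `[- 2^-1, 2^-1].
  apply: (@subclosed_compact _ Q C).
  - apply: closedI.
      by apply: preimage_closed => // q _; exact: cvg_fst.
    apply: closed_sublevel => q; apply: cvgM.
      have h : (2 * x.2) @[x --> q] --> 2 * q.2 by apply: cvgM; [exact: cvg_cst|exact: c2].
      exact: (cvgM h h).
    apply: cvgD; first exact: cvg_cst.
    exact: (cvgM (c12 q) (c12 q)).
  - by do 2! (apply: compact_setX; last exact: segment_compact); exact: segment_compact.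
  - move=> [[a s] y] [/= /Pb /= [a01 sM] /height_bounds[yh _]].
    by rewrite /C /= !in_itv /= -!ler_norml.
rewrite (_ : pencil P = (fun q : (R * R) * R => (q.1.1 + q.1.2 * q.2, q.2)) @` Q).
  apply: continuous_compact => //; apply: continuous_subspaceT.
  apply: continuous_pair => // q; apply: cvgD; first exact: c11.
  exact: (cvgM (c12 q) (c2 q)).
apply/seteqP; split=> [[x y] [p Pp /= [-> h]]|_ [[p y] [Pp /= h] <-]].
  by exists (p, y).
by exists p.
Qed.

Lemma horizontal_axis_negligible : (@lebesgue_measure2 R).-negligible (setT `*` [set 0]).
Proof.
pose mu := [the {sigma_finite_measure set _ -> \bar R} of @lebesgue_measure R].
exists (setT `*` [set 0]); split => //; first exact: measurableX.
apply: etrans (product_measure1E mu mu measurableT (measurable_set1 0)) _ => /=.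
by rewrite lebesgue_measure_set1 mule0.
Qed.

End Segments.

(** * Assembling the set from bounded ranges of slopes *)

Theorem theorem1p2 (R : realType) (A : set R) :
  A `<=` `[0, 1] -> perfect_set A -> A 0 ->
  exists E : set (R * R),
    [/\ (@lebesgue_measure2 R).-negligible E,
        (forall e : R * R, unit_circle e -> e <> (1, 0) -> e <> (-1, 0) ->
           exists2 a : R, A a & unit_segment (a, 0) e `<=` E),
        E `&` (setT `*` [set 0]) = A `*` [set 0] &
        compact (E `|` `[-1, 2] `*` [set 0])].
Proof.
move=> A01 pA A0.
have A_limit a e := @perfect_limit R A a e pA.
have cA : compact A.
  by apply: subclosed_compact A01; [exact: pA.1|exact: segment_compact].
(* Two unit intervals of slopes make up n <= |s| <= n + 1; both start with the label 0, a point of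
   [A]. Bounded ranges keep each pencil compact. *)
pose K (n : nat) : seq (brick R) :=
  [:: (0, n%:R + 2^-1, 2^-1); (0, - (n%:R + 2^-1), 2^-1)].
have wfK n b : b \in K n -> A (lab b) /\ 0 < hwid b.
  by rewrite !inE => /orP[|] /eqP -> /=; split => //; rewrite invr_gt0.
have coversK n s : covers (K n) s <-> n%:R <= `|s| <= n%:R + 1.
  have n0 : (0 : R) <= n%:R by [].
  split=> [[b]|sn].
    rewrite !inE => /orP[|] /eqP -> /=; rewrite ler_norml => sb.
      by rewrite ger0_norm; lra.
    by rewrite ler0_norm; lra.
  have [s0|s0] := leP 0 s.
    exists (0, n%:R + 2^-1, 2^-1); first by rewrite !inE eqxx.
    by move: sn; rewrite ger0_norm //= ler_norml; lra.
  exists (0, - (n%:R + 2^-1), 2^-1); first by rewrite !inE eqxx orbT.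
  by move: sn; rewrite ltr0_norm //= ler_norml; lra.
have /choice[P Pspec] := fun n => null_pencil A A_limit cA _ (wfK n).
have PA n p : P n p -> A p.1 by case: (Pspec n) => _ + _ _ => /[apply] -[].
have Ps n p : P n p -> n%:R <= `|p.2| <= n%:R + 1.
  by case: (Pspec n) => _ + _ _ => /[apply] -[_ /coversK].
have pencil_cpt n : compact (pencil (P n)).
  apply: (@compact_pencil R _ (n%:R + 1)); first by case: (Pspec n).
  move=> p Pp; have /A01 := PA _ _ Pp; rewrite /= in_itv /=; split => //.
  by case/andP: (Ps _ _ Pp).
(* Adjoining A x {0} makes the section at height 0 all of [A], even if some of its points carry no
   segment. *)
pose E := (\bigcup_n pencil (P n)) `|` (A `*` [set 0]).
exists E; split.
- apply: negligibleU.
    apply: negligible_bigcup => n; have [_ _ _ nP] := Pspec n.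
    apply: negligibleS (negligibleU nP horizontal_axis_negligible).
    move=> [x y] [p Pp /= [xE _]]; have [->|y0] := eqVneq y 0; first by right.
    by left; split => //; exists p.
  by apply: negligibleS horizontal_axis_negligible => -[x y] [].
- move=> [e1 e2] /= e12 eN1 eN2.
  have e20 : e2 != 0.
    apply/eqP => e20; move: e12; rewrite /unit_circle /= e20 expr0n /= addr0.
    move=> /eqP; rewrite sqrf_eq1 => /orP[/eqP e1E|/eqP e1E].
      by apply: eN1; rewrite e1E e20.
    by apply: eN2; rewrite e1E e20.
  pose s := e1 / e2.
  have [a Pa] : exists a, P (Num.truncn `|s|) (a, s).
    have [_ _ + _] := Pspec (Num.truncn `|s|); apply; apply/coversK.
    by apply/andP; split; [by rewrite truncn_le|rewrite natr1; exact: ltW (truncnS_gt _)].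
  exists a; first exact: (PA _ _ Pa).
  move=> _ [t /= + <-]; rewrite in_itv /= => tle; left.
  exists (Num.truncn `|s|) => //; exists (a, s) => //=; split.
    by rewrite add0r /GRing.scale /= /s mulrCA divfK.
  rewrite add0r /GRing.scale /=.
  have -> : (2 * (t * e2)) ^+ 2 * (1 + s ^+ 2) = (2 * t) ^+ 2 * (e1 ^+ 2 + e2 ^+ 2).
    by rewrite /s; field.
  rewrite e12 mulr1 expr2; nra.
- apply/seteqP; split=> [[x y]|[x y] [/= Ax ->]]; last by split; [right|].
  move=> [[[n _ [p Pp /= [xE _]]]|//] [_ /= y0]].
  by split => //=; rewrite xE y0 mulr0 addr0; exact: PA Pp.
(* These boxes shrink to [-1, 2] x {0}. Slopes of size at least n force heights at most 1 / (n + 1),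
   so the n-th box contains all pencils of index at least n, and the set is an intersection of
   closed sets lying in the first box. *)
- pose H n : set (R * R) := `[-1, 2] `*` `[- n.+1%:R^-1, n.+1%:R^-1].
  have cH n : compact (H n) by apply: compact_setX; exact: segment_compact.
  have hd : hausdorff_space (R * R)%type by exact: norm_hausdorff.
  have -> : E `|` `[-1, 2] `*` [set 0] =
      \bigcap_n (\bigcup_(j in `I_n) pencil (P j) `|` H n).
    have inv0 n : 0 <= n.+1%:R^-1 :> R by rewrite invr_ge0.
    apply/seteqP; split=> [[x y]|[x y] xy].
      case=> [[[j _ Pj]|[/= Ax ->]]|[/= x12 ->]] n _; last 2 first.
      - right; split; rewrite /= in_itv /=; last by rewrite oppr_le0 inv0.
        by have := A01 _ Ax; rewrite /= in_itv /=; lra.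
      - by right; split => //; rewrite /= in_itv /= oppr_le0 inv0.
      have [jn|nj] := ltnP j n; first by left; exists j.
      right; case: Pj => p Pp /= [-> hy].
      have [yh syh] := height_bounds _ _ hy.
      have /A01 := PA _ _ Pp; rewrite /= in_itv /= => p01.
      split; rewrite /= in_itv /=.
        by move: syh; rewrite ler_norml; lra.
      have /andP[jp _] := Ps _ _ Pp.
      have np : n%:R <= `|p.2| by apply: le_trans jp; rewrite ler_nat.
      have np2 : n%:R ^+ 2 <= p.2 ^+ 2.
        by rewrite -(real_normK (num_real p.2)) ler_sqr ?nnegrE.
      have n10 : (0 : R) < n.+1%:R by rewrite ltr0n.
      rewrite -ler_norml -[n.+1%:R^-1]mul1r ler_pdivlMr// -(gtr0_norm n10) -normrM.
      rewrite -ler_sqr ?nnegrE// expr1n real_normK ?num_real//.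
      have y20 := sqr_ge0 y.
      (* This follows from (n - 1)^2 >= 0 and n^2 <= p.2^2. *)
      have sq1 : n.+1%:R ^+ 2 <= 4 * (1 + p.2 ^+ 2).
        rewrite -natr1; have := sqr_ge0 (n%:R - 1 : R); have := sqr_ge0 p.2; lra.
      have := ler_wpM2l y20 sq1; move: hy; rewrite /= !exprMn; lra.
    have [y0|y0] := eqVneq y 0.
      right; split => //=.
      by have [[j]|[]] := xy 0%N I.
    have ny0 : 0 < `|y| by rewrite normr_gt0.
    (* For this n the n-th box lies below height |y|, so the point must belong to a pencil. *)
    have [n] := ltr_add_invr ny0; rewrite add0r => ny.
    have [[j _ Pj]|[_ /=]] := xy n I; first by left; left; exists j.
    by rewrite in_itv /= -ler_norml leNgt ny.
  have clH n : closed (H n) by exact: compact_closed.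
  apply: (@subclosed_compact _ _ (H 0%N)) => //.
    apply: closed_bigI => n _; apply: closedU => //.
    by apply: closed_bigcup => // j _; exact: compact_closed.
  by move=> z /(_ 0%N I) [[j]|].
Qed.
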